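(* Let $\mathrm{T}$ be a $3$-form in $\mathbb{R}^{2k}$ and suppose that there exists a $2$-form $\Omega$ on $\mathbb{R}^{2k}$ such that $$\Omega^k\neq 0\quad\text{and}\quad[\mathfrak{g}_{\mathrm{T}}^*,\Omega]=0 .$$ Then $\mathrm{T}=0$.
   Context: $\mathbb{R}^{n}$ ($n=2k$) carries its standard inner product. $\mathrm{Cl}(\mathbb{R}^n)$ is the Clifford algebra with $X\cdot X=-\|X\|^2$, identified as a vector space with $\Lambda^*(\mathbb{R}^n)$ (via $e_{i_1}\wedge\dots\wedge e_{i_r}\mapsto e_{i_1}\cdots e_{i_r}$ for an orthonormal basis), and $\mathfrak{cl}(\mathbb{R}^n)$ is the Lie algebra with bracket $[\alpha,\beta]=\alpha\cdot\beta-\beta\cdot\alpha$; the $2$-forms constitute the Lie subalgebra $\mathfrak{so}(n)$. $\mathfrak{g}_{\mathrm{T}}^*\subset\mathfrak{so}(n)$ is the Lie subalgebra generated by all $2$-forms $X\lrcorner\,\mathrm{T}$ (interior product), $X\in\mathbb{R}^n$. $\Omega^k$ denotes the $k$-fold exterior power $\Omega\wedge\dots\wedge\Omega$, and $[\mathfrak{g}_{\mathrm{T}}^*,\Omega]=0$ means that $\Omega$ commutes with every element of $\mathfrak{g}_{\mathrm{T}}^*$. *)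

(* Defs.v *)
From HB Require Import structures.
From mathcomp Require Import all_boot all_order all_algebra.
Set Implicit Arguments.
Unset Strict Implicit.
Unset Printing Implicit Defensive.
Import GRing.Theory.
Local Open Scope ring_scope.

(* The common underlying vector space of the exterior algebra and of the      *)
(* Clifford algebra of R^n. The value a I is the coordinate of a on the basis *)
(* element indexed by I = {i_1 < ... < i_r}, which is e_{i_1} /\ ... /\       *)
(* e_{i_r} for the exterior product and e_{i_1} ... e_{i_r} for the Clifford  *)
(* product (wedge_prod and clif_prod below). Pitfall: _ * _ and _ ^+ _ would  *)
(* be the pointwise operations of finite functions; use wedge and clif.       *)
Definition forms (R : comNzRingType) (n : nat) : Type :=
  {ffun {set 'I_n} -> R^o}.
HB.instance Definition _ (R : comNzRingType) (n : nat) :=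
  GRing.Lmodule.copy (forms R n) {ffun {set 'I_n} -> R^o}.

Section Definitions.
Variables (R : comNzRingType) (n : nat).
Implicit Types (I J : {set 'I_n}) (a b : forms R n) (X : 'rV[R]_n).

Definition coef a I : R := fun_of_fin a I.

Definition ebase I : forms R n := [ffun J => (J == I)%:R].

Definition one_form : forms R n := ebase set0.

Definition vec X : forms R n := \sum_(i < n) X 0 i *: ebase [set i].

Definition is_form (p : nat) a : Prop :=
  forall I, #|I| != p -> coef a I = 0.

Definition bilin (m : {set 'I_n} -> {set 'I_n} -> forms R n) a b : forms R n :=
  \sum_I \sum_J (coef a I * coef b J) *: m I J.

(* Sorting e_I e_J into increasing order takes one transposition for each     *)
(* pair (i, j) in I x J with j < i.                                           *)
Definition wedge_ebase I J : forms R n :=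
  if [disjoint I & J]
  then (-1) ^+ (\sum_(i in I) \sum_(j in J) (j < i)%N) *: ebase (I :|: J)
  else 0.

Definition wedge : forms R n -> forms R n -> forms R n := bilin wedge_ebase.

Definition wedge_pow a (k : nat) : forms R n := iterop k wedge a one_form.

Definition symdiff I J : {set 'I_n} := (I :\: J) :|: (J :\: I).

(* In the Clifford algebra each i common to I and J also cancels as           *)
(* e_i e_i = -1, hence the non-strict comparison.                             *)
Definition clif_ebase I J : forms R n :=
  (-1) ^+ (\sum_(i in I) \sum_(j in J) (j <= i)%N) *: ebase (symdiff I J).

Definition clif : forms R n -> forms R n -> forms R n := bilin clif_ebase.

Definition bracket a b : forms R n := clif a b - clif b a.

(* Interior product: e_i _| e_I moves e_i past the smaller elements of I.     *)
Definition contract X a : forms R n :=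
  \sum_(i < n) \sum_(I : {set 'I_n} | i \in I)
    (X 0 i * coef a I) *:
      ((-1) ^+ (\sum_(j in I) (j < i)%N) *: ebase (I :\ i)).

Definition lie_subalgebra (S : forms R n -> Prop) : Prop :=
  [/\ S 0,
      forall (c : R) a b, S a -> S b -> S (c *: a + b)
    & forall a b, S a -> S b -> S (bracket a b)].

Definition lie_generated (G : forms R n -> Prop) : forms R n -> Prop :=
  fun a => forall S, lie_subalgebra S -> (forall b, G b -> S b) -> S a.

Definition gT (T : forms R n) : forms R n -> Prop :=
  lie_generated (fun b => exists X, b = contract X T).

End Definitions.

Arguments ebase {R n} I.
Arguments one_form {R n}.

Section Theory.
Variables (R : comNzRingType) (n : nat).
Implicit Types (I J K : {set 'I_n}) (a b c : forms R n) (X Y : 'rV[R]_n).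

Lemma formP a b : (forall I, coef a I = coef b I) <-> a = b.
Proof. by split=> [e|->//]; apply/ffunP=> I; apply: e. Qed.

Lemma coefD a b I : coef (a + b) I = coef a I + coef b I.
Proof. by rewrite /coef ffunE. Qed.

Lemma coefN a I : coef (- a) I = - coef a I.
Proof. by rewrite /coef ffunE. Qed.

Lemma coefB a b I : coef (a - b) I = coef a I - coef b I.
Proof. by rewrite coefD coefN. Qed.

Lemma coefZ (x : R) a I : coef (x *: a) I = x * coef a I.
Proof. by rewrite /coef ffunE. Qed.

Lemma coef0 I : coef (0 : forms R n) I = 0.
Proof. by rewrite /coef ffunE. Qed.

Lemma coef_sum (T : Type) (r : seq T) (P : pred T) (F : T -> forms R n) I :
  coef (\sum_(t <- r | P t) F t) I = \sum_(t <- r | P t) coef (F t) I.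
Proof. by elim/big_rec2: _ => [|t y z _ <-]; rewrite ?coef0 ?coefD. Qed.

Lemma coef_ebase I J : coef (ebase I : forms R n) J = (J == I)%:R.
Proof. by rewrite /coef ffunE. Qed.

Lemma form_ebase a : a = \sum_I coef a I *: ebase I.
Proof.
apply/formP=> J; rewrite coef_sum (bigD1 J) //= big1 => [|I neIJ].
  by rewrite coefZ coef_ebase eqxx mulr1 addr0.
by rewrite coefZ coef_ebase eq_sym (negPf neIJ) mulr0.
Qed.

Lemma form_ext (f g : forms R n -> forms R n) :
  {morph f : x y / x + y} * (forall k, {morph f : x / k *: x}) ->
  {morph g : x y / x + y} * (forall k, {morph g : x / k *: x}) ->
  (forall I, f (ebase I) = g (ebase I)) -> f =1 g.
Proof.
have F (h : forms R n -> forms R n) :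
    {morph h : x y / x + y} * (forall k, {morph h : x / k *: x}) ->
  forall a, h a = \sum_I coef a I *: h (ebase I).
  move=> [hD hZ] a; have h0 : h 0 = 0 by have := hZ 0 0; rewrite !scale0r.
  rewrite {1}[a]form_ebase.
  by elim/big_rec2: _ => // I x y _ <-; rewrite hD hZ.
move=> /F fE /F gE fg a; rewrite fE gE.
by apply: eq_bigr => I _; rewrite fg.
Qed.

Section Bilin.
Variable m : {set 'I_n} -> {set 'I_n} -> forms R n.

Lemma bilinDl a a' b : bilin m (a + a') b = bilin m a b + bilin m a' b.
Proof.
rewrite /bilin -big_split; apply: eq_bigr => I _ /=; rewrite -big_split.
by apply: eq_bigr => J _; rewrite coefD mulrDl scalerDl.
Qed.

Lemma bilinDr a b b' : bilin m a (b + b') = bilin m a b + bilin m a b'.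
Proof.
rewrite /bilin -big_split; apply: eq_bigr => I _ /=; rewrite -big_split.
by apply: eq_bigr => J _; rewrite coefD mulrDr scalerDl.
Qed.

Lemma bilinZl (x : R) a b : bilin m (x *: a) b = x *: bilin m a b.
Proof.
rewrite /bilin scaler_sumr; apply: eq_bigr => I _; rewrite scaler_sumr.
by apply: eq_bigr => J _; rewrite coefZ scalerA mulrA.
Qed.

Lemma bilinZr (x : R) a b : bilin m a (x *: b) = x *: bilin m a b.
Proof.
rewrite /bilin scaler_sumr; apply: eq_bigr => I _; rewrite scaler_sumr.
by apply: eq_bigr => J _; rewrite coefZ scalerA mulrCA.
Qed.

Lemma bilin0l b : bilin m 0 b = 0.
Proof. by have := bilinZl 0 0 b; rewrite !scale0r. Qed.

Lemma bilin0r a : bilin m a 0 = 0.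
Proof. by have := bilinZr 0 a 0; rewrite !scale0r. Qed.

Lemma bilin_suml (T : Type) (r : seq T) (P : pred T) (F : T -> forms R n) b :
  bilin m (\sum_(t <- r | P t) F t) b = \sum_(t <- r | P t) bilin m (F t) b.
Proof. by elim/big_rec2: _ => [|t y z _ <-]; rewrite ?bilin0l ?bilinDl. Qed.

Lemma bilin_sumr (T : Type) (r : seq T) (P : pred T) (F : T -> forms R n) a :
  bilin m a (\sum_(t <- r | P t) F t) = \sum_(t <- r | P t) bilin m a (F t).
Proof. by elim/big_rec2: _ => [|t y z _ <-]; rewrite ?bilin0r ?bilinDr. Qed.

Lemma bilin_ebase I J : bilin m (ebase I) (ebase J) = m I J.
Proof.
rewrite /bilin (bigD1 I) //= [X in _ + X]big1 => [|K neKI].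
  rewrite addr0 (bigD1 J) //= [X in _ + X]big1 => [|K neKJ].
    by rewrite !coef_ebase !eqxx mulr1 scale1r addr0.
  by rewrite !coef_ebase (negPf neKJ) mulr0 scale0r.
by rewrite big1 // => L _; rewrite coef_ebase (negPf neKI) mul0r scale0r.
Qed.

Lemma bilinA :
  (forall I J K, bilin m (ebase I) (m J K) = bilin m (m I J) (ebase K)) ->
  associative (bilin m).
Proof.
move=> mA a b c.
apply: (@form_ext (fun a => bilin m a (bilin m b c))
                  (fun a => bilin m (bilin m a b) c)).
- by split=> [x y|x y]; rewrite ?bilinDl ?bilinZl.
- by split=> [x y|x y]; rewrite ?bilinDl ?bilinZl.
move=> I; apply: (@form_ext (fun b => bilin m (ebase I) (bilin m b c))
                            (fun b => bilin m (bilin m (ebase I) b) c)).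
- by split=> [x y|x y]; rewrite ?bilinDl ?bilinDr ?bilinZl ?bilinZr.
- by split=> [x y|x y]; rewrite ?bilinDr ?bilinDl ?bilinZr ?bilinZl.
move=> J; apply: (@form_ext
  (fun c => bilin m (ebase I) (bilin m (ebase J) c))
  (fun c => bilin m (bilin m (ebase I) (ebase J)) c)).
- by split=> [x y|x y]; rewrite ?bilinDr ?bilinDr ?bilinZr ?bilinZr.
- by split=> [x y|x y]; rewrite ?bilinDr ?bilinZr.
by move=> K; rewrite !bilin_ebase.
Qed.

Lemma bilin_1l :
  (forall I, m set0 I = ebase I) -> left_id one_form (bilin m).
Proof.
move=> m1 a; rewrite {2}[a]form_ebase {1}[a]form_ebase bilin_sumr.
by apply: eq_bigr => I _; rewrite bilinZr bilin_ebase m1.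
Qed.

Lemma bilin_1r :
  (forall I, m I set0 = ebase I) -> right_id one_form (bilin m).
Proof.
move=> m1 a; rewrite {2}[a]form_ebase {1}[a]form_ebase bilin_suml.
by apply: eq_bigr => I _; rewrite bilinZl bilin_ebase m1.
Qed.

End Bilin.

Lemma in_symdiff I J i : (i \in symdiff I J) = (i \in I) (+) (i \in J).
Proof. by rewrite !inE; case: (i \in I); case: (i \in J). Qed.

Lemma symdiffA : associative (@symdiff n).
Proof. by move=> I J K; apply/setP=> i; rewrite !in_symdiff addbA. Qed.

Lemma symdiffC : commutative (@symdiff n).
Proof. by move=> I J; apply/setP=> i; rewrite !in_symdiff addbC. Qed.

Lemma odd_sum_symdiff I J (f : 'I_n -> nat) :
  odd (\sum_(i in symdiff I J) f i) =
  odd (\sum_(i in I) f i) (+) odd (\sum_(i in J) f i).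
Proof.
rewrite -oddD [in RHS](big_setID J) [X in (_ + X)%N](big_setID I) /=.
rewrite (setIC J I) addnACA oddD addnn odd_double /=.
rewrite (big_setID J) (_ : symdiff I J :&: J = J :\: I) => [|]; last first.
  by apply/setP=> i; rewrite !inE; case: (i \in I); case: (i \in J).
rewrite (_ : symdiff I J :\: J = I :\: J) 1?addnC //.
by apply/setP=> i; rewrite !inE; case: (i \in I); case: (i \in J).
Qed.

Lemma sign_symdiff I J (f : 'I_n -> nat) :
  (-1) ^+ (\sum_(i in symdiff I J) f i) =
  (-1) ^+ (\sum_(i in I) f i) * (-1) ^+ (\sum_(i in J) f i) :> R.
Proof.
by rewrite -signr_odd odd_sum_symdiff signr_addb !signr_odd.
Qed.

Lemma sign_sum_symdiff I J K (f : 'I_n -> 'I_n -> nat) :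
  (-1) ^+ (\sum_(i in I) \sum_(j in symdiff J K) f i j) =
  (-1) ^+ (\sum_(i in I) \sum_(j in J) f i j) *
  (-1) ^+ (\sum_(i in I) \sum_(j in K) f i j) :> R.
Proof.
have E L : (\sum_(i in I) \sum_(j in L) f i j =
            \sum_(j in L) \sum_(i in I) f i j)%N by rewrite exchange_big.
by rewrite !E sign_symdiff.
Qed.

Lemma disjoint_symdiff I J : [disjoint I & J] -> I :|: J = symdiff I J.
Proof.
move/pred0P=> dIJ; apply/setP=> i; rewrite in_symdiff inE.
by have /= := dIJ i; case: (i \in I); case: (i \in J).
Qed.

Lemma clifA : associative (@clif R n).
Proof.
apply: bilinA => I J K; rewrite /clif_ebase bilinZl bilinZr !bilin_ebase.
rewrite !scalerA symdiffA sign_symdiff sign_sum_symdiff.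
by congr (_ *: _); rewrite mulrC -!mulrA; congr (_ * _).
Qed.

Lemma symdiff0l I : symdiff set0 I = I.
Proof. by apply/setP=> i; rewrite in_symdiff inE. Qed.

Lemma symdiff0r I : symdiff I set0 = I.
Proof. by rewrite symdiffC symdiff0l. Qed.

Lemma symdiffI I : symdiff I I = set0.
Proof. by apply/setP=> i; rewrite in_symdiff addbb inE. Qed.

Lemma clif1f : left_id one_form (@clif R n).
Proof.
apply: bilin_1l => I; rewrite /clif_ebase big_set0 expr0 scale1r.
by rewrite symdiff0l.
Qed.

Lemma clif_f1 : right_id one_form (@clif R n).
Proof.
apply: bilin_1r => I; rewrite /clif_ebase big1 => [|i _]; last first.
  by rewrite big_set0.
by rewrite expr0 scale1r symdiff0r.
Qed.

Lemma wedgeA : associative (@wedge R n).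
Proof.
apply: bilinA => I J K; rewrite /wedge_ebase.
have dU (A B C : {set 'I_n}) : [disjoint A :|: B & C] =
    [disjoint A & C] && [disjoint B & C].
  by rewrite -!setI_eq0 setIUl setU_eq0.
have dUr (A B C : {set 'I_n}) : [disjoint A & B :|: C] =
    [disjoint A & B] && [disjoint A & C].
  by rewrite ![[disjoint A & _]]disjoint_sym dU.
case: (boolP [disjoint J & K]) => dJK; last first.
  rewrite bilin0r; case: ifP => dIJ; last by rewrite bilin0l.
  by rewrite bilinZl bilin_ebase dU (negPf dJK) andbF scaler0.
rewrite bilinZr bilin_ebase dUr.
case: (boolP [disjoint I & J]) => dIJ; last by rewrite bilin0l scaler0.
rewrite bilinZl bilin_ebase dU dJK andbT /=.
case: (boolP [disjoint I & K]) => dIK; last by rewrite !scaler0.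
rewrite !scalerA setUA (disjoint_symdiff dJK) sign_sum_symdiff.
rewrite (disjoint_symdiff dIJ) sign_symdiff.
by congr (_ *: _); rewrite mulrC -!mulrA; congr (_ * _).
Qed.

Lemma wedge1f : left_id one_form (@wedge R n).
Proof.
apply: bilin_1l => I; rewrite /wedge_ebase -setI_eq0 set0I eqxx set0U.
by rewrite big_set0 expr0 scale1r.
Qed.

Lemma wedgef1 : right_id one_form (@wedge R n).
Proof.
apply: bilin_1r => I; rewrite /wedge_ebase -setI_eq0 setI0 eqxx setU0.
by rewrite big1 ?expr0 ?scale1r // => i _; rewrite big_set0.
Qed.

Lemma clif_vecl X a : clif (vec X) a = wedge (vec X) a - contract X a.
Proof.
rewrite [in LHS]/vec [in X in X - _]/vec /clif /wedge !bilin_suml /contract.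
rewrite -sumrB; apply: eq_bigr => i _; rewrite !bilinZl.
rewrite (eq_bigr (fun I => X 0 i *: (coef a I *:
   ((-1) ^+ (\sum_(j in I) (j < i)%N) *: ebase (I :\ i))))); last first.
  by move=> I _; rewrite scalerA.
rewrite -scaler_sumr -scalerBr; congr (_ *: _).
rewrite {1 2}[a]form_ebase !bilin_sumr [X in _ = _ - X]big_mkcond /= -sumrB.
apply: eq_bigr => I _; rewrite !bilinZr !bilin_ebase /clif_ebase /wedge_ebase.
rewrite !big_set1 disjoints1.
have lei (j : 'I_n) : j != i -> (j <= i)%N = (j < i)%N.
  by move=> ji; rewrite ltn_neqAle (inj_eq val_inj) ji.
case: (boolP (i \in I)) => iI /=; last first.
  rewrite subr0 (@disjoint_symdiff [set i]) ?disjoints1 //.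
  congr (_ *: (_ ^+ _ *: _)); apply: eq_bigr => j jI; rewrite lei //.
  by apply: contraNneq iI => <-.
rewrite scaler0 sub0r -scalerN -scaleNr; congr (_ *: (_ *: _)).
  rewrite (bigD1 i) //= leqnn (bigD1 i iI) /= ltnn add0n add1n exprS mulN1r.
  by congr (- (_ ^+ _)); apply: eq_bigr => j /andP[_ /lei->].
congr (ebase _); apply/setP=> j; rewrite in_symdiff !inE.
by case: eqVneq => [->|_] //=; rewrite iI.
Qed.

Lemma clif_ebase_sqr (i : 'I_n) :
  clif (ebase [set i]) (ebase [set i]) = - one_form :> forms R n.
Proof.
by rewrite /clif bilin_ebase /clif_ebase !big_set1 leqnn symdiffI scaleN1r.
Qed.

Lemma clif_ebaseC (i j : 'I_n) : i != j ->
  clif (ebase [set i]) (ebase [set j]) =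
  - clif (ebase [set j]) (ebase [set i]) :> forms R n.
Proof.
move=> neij; rewrite /clif !bilin_ebase /clif_ebase !big_set1 symdiffC.
rewrite -scaleNr; congr (_ *: _).
by case: (ltngtP i j) neij => [||/val_inj->]; rewrite ?eqxx ?opprK.
Qed.

Lemma clif_vec_sqr X :
  clif (vec X) (vec X) = - (\sum_(i < n) X 0 i ^+ 2) *: one_form.
Proof.
pose F (i j : 'I_n) := (X 0 i * X 0 j) *: clif (ebase [set i]) (ebase [set j]).
have -> : clif (vec X) (vec X) = \sum_i \sum_j F i j.
  rewrite {1}/vec /clif bilin_suml; apply: eq_bigr => i _.
  rewrite bilinZl /vec bilin_sumr scaler_sumr; apply: eq_bigr => j _.
  by rewrite bilinZr scalerA.
have -> : \sum_i \sum_j F i j =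
    \sum_i F i i + (\sum_(i < n) \sum_(j < n | (j < i)%N) F i j +
                     \sum_(i < n) \sum_(j < n | (i < j)%N) F i j).
  rewrite -!big_split; apply: eq_bigr => i _ /=; rewrite (bigD1 i) //=.
  congr (_ + _); rewrite (bigID (fun j : 'I_n => j < i)%N) /=.
  congr (_ + _); apply: eq_bigl => j; rewrite -(inj_eq val_inj) /=.
    by rewrite neq_ltn; case: ltngtP.
  by rewrite neq_ltn; case: ltngtP.
rewrite [X in _ + (_ + X)](exchange_big_dep xpredT) //= -big_split /=.
rewrite [X in _ + X]big1 => [|i _]; last first.
  rewrite -big_split big1 //= => j ltji; rewrite /F [X 0 j * _]mulrC.
  rewrite -scalerDr clif_ebaseC ?addNr ?scaler0 //.
  by rewrite neq_ltn ltji orbT.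
rewrite addr0 scaleNr scaler_suml -sumrN; apply: eq_bigr => i _.
by rewrite /F clif_ebase_sqr scalerN expr2.
Qed.

Lemma sorted_enum_ord I : sorted (relpre val ltn) (enum I).
Proof.
rewrite {1}/enum_mem -enumT; apply: sorted_filter.
  by move=> i j k; apply: ltn_trans.
by rewrite -sorted_map val_enum_ord iota_ltn_sorted.
Qed.

Lemma big_ebase (m : {set 'I_n} -> {set 'I_n} -> forms R n) I :
  (forall (i : 'I_n) J, (forall j, j \in J -> (i < j)%N) ->
     m [set i] J = ebase (i |: J)) ->
  \big[bilin m/one_form]_(i <- enum I) ebase [set i] = ebase I.
Proof.
move=> mE.
suff H (s : seq 'I_n) : sorted (relpre val ltn) s ->
    \big[bilin m/one_form]_(i <- s) ebase [set i] =
    (ebase [set i in s] : forms R n).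
  by rewrite H ?sorted_enum_ord // set_enum.
elim: s => [|i s IHs] /=; first by rewrite big_nil set_nil.
rewrite (path_sortedE (fun j k l => @ltn_trans _ _ _)).
move=> /andP[/allP lt_is s_s].
rewrite big_cons IHs // bilin_ebase mE ?set_cons // => j.
by rewrite inE => /lt_is.
Qed.

Lemma wedge_prod I :
  \big[@wedge R n/one_form]_(i <- enum I) ebase [set i] = ebase I.
Proof.
apply: big_ebase => i J ltiJ; rewrite /wedge_ebase disjoints1.
rewrite ifT; last by apply/negP=> /ltiJ; rewrite ltnn.
rewrite big_set1 big1 ?expr0 ?scale1r // => j /ltiJ.
by rewrite ltnNge; case: ltngtP.
Qed.

Lemma clif_prod I :
  \big[@clif R n/one_form]_(i <- enum I) ebase [set i] = ebase I.
Proof.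
apply: big_ebase => i J ltiJ; rewrite /clif_ebase -disjoint_symdiff.
  rewrite big_set1 big1 ?expr0 ?scale1r // => j /ltiJ.
  by rewrite ltnNge => /negPf->.
by rewrite disjoints1; apply/negP=> /ltiJ; rewrite ltnn.
Qed.

Lemma clif_ebaseX I J :
  clif (ebase I) (ebase J) =
  (-1) ^+ (#|I| * #|J| + #|I :&: J|) *: clif (ebase J) (ebase I) :> forms R n.
Proof.
rewrite /clif !bilin_ebase /clif_ebase scalerA symdiffC; congr (_ *: _).
rewrite [X in _ = _ * _ ^+ X]exchange_big -exprD /=.
have -> : (#|I| * #|J| + #|I :&: J| =
  \sum_(i in I) \sum_(j in J) (1 + (j == i)))%N.
  under eq_bigr => i _ do rewrite big_split /= sum1_card.
  rewrite big_split /= sum_nat_const; congr (_ + _)%N.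
  rewrite -sum1_card (eq_bigl (fun i => (i \in I) && (i \in J))) => [|i].
    rewrite big_mkcondr; apply: eq_bigr => i _ /=.
    case: ifP => iJ; last first.
      by rewrite big1 // => j jJ; case: eqP jJ => // ->; rewrite iJ.
    by rewrite (bigD1 i) //= eqxx big1 // => j /andP[_ /negPf->].
  by rewrite inE.
rewrite -big_split /= -signr_odd -[RHS]signr_odd; congr (_ ^+ nat_of_bool _).
rewrite !(big_morph odd oddD (erefl _)); apply: eq_bigr => i _.
rewrite -big_split /= !(big_morph odd oddD (erefl _)); apply: eq_bigr => j _.
by rewrite -(inj_eq val_inj) /=; case: ltngtP.
Qed.

Lemma is_form_lin (p : nat) (x : R) a b :
  is_form p a -> is_form p b -> is_form p (x *: a + b).
Proof.
by move=> pa pb I nI; rewrite coefD coefZ pa // pb // mulr0 addr0.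
Qed.

Lemma so_lie_subalgebra : lie_subalgebra (@is_form R n 2).
Proof.
split=> [I _|x a b|a b a2 b2 K cK]; [exact: coef0|exact: is_form_lin|].
have -> : bracket a b = \sum_I \sum_J (coef a I * coef b J) *:
    bracket (ebase I) (ebase J).
  rewrite /bracket /clif {1}/bilin [bilin _ b a]/bilin [X in _ - X]exchange_big.
  rewrite -sumrB; apply: eq_bigr => I _; rewrite -sumrB; apply: eq_bigr => J _.
  by rewrite /= !bilin_ebase scalerBr [coef b J * _]mulrC.
rewrite coef_sum big1 // => I _; rewrite coef_sum big1 // => J _; rewrite coefZ.
have [cI|/a2->] := eqVneq #|I| 2; last by rewrite !mul0r.
have [cJ|/b2->] := eqVneq #|J| 2; last by rewrite mulr0 mul0r.
rewrite /bracket clif_ebaseX cI cJ; have [oIJ|eIJ] := boolP (odd #|I :&: J|).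
  have cIJ : #|I :&: J| = 1%N.
    have := subset_leq_card (subsetIl I J); rewrite cI.
    by case: #|I :&: J| oIJ => [|[|[|]]].
  have cS : #|symdiff J I| = 2.
    rewrite /symdiff cardsU !cardsD [J :&: I]setIC cI cJ cIJ.
    rewrite (_ : _ :&: _ = set0) ?cards0 //.
    by apply/setP=> i; rewrite !inE; case: (i \in I); case: (i \in J).
  rewrite coefB coefZ /clif bilin_ebase /clif_ebase coefZ coef_ebase.
  have /negPf-> : K != symdiff J I by apply: contraNneq cK => ->; rewrite cS.
  by rewrite !mulr0 subrr mulr0.
by rewrite -signr_odd oddD (negPf eIJ) expr0 scale1r subrr coef0 mulr0.
Qed.

Lemma is_form_contract (p : nat) X a :
  is_form p.+1 a -> is_form p (contract X a).
Proof.
move=> pa K nK; rewrite coef_sum big1 // => i _.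
rewrite coef_sum big1 // => I iI.
rewrite !coefZ coef_ebase; have [cI|/pa->] := eqVneq #|I| p.+1; last first.
  by rewrite mulr0 mul0r.
case: eqP => [eK|]; last by rewrite !mulr0.
by move: cI; rewrite (cardsD1 i) iI -eK add1n => -[/eqP]; rewrite (negPf nK).
Qed.

Lemma gT_so (T : forms R n) a : is_form 3 T -> gT T a -> is_form 2 a.
Proof.
move=> T3; apply; first exact: so_lie_subalgebra.
by move=> _ [X ->]; apply: is_form_contract.
Qed.

End Theory.

(* Main.v *)
Require Import Defs.
From mathcomp Require Import all_boot all_order all_algebra.
From mathcomp Require Import reals.
Set Implicit Arguments.
Unset Strict Implicit.
Unset Printing Implicit Defensive.
Import GRing.Theory.
Import Defs.
Local Open Scope ring_scope.

(** Write i_X for the interior product by a vector X, w(X) for the vector dual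
    to the 1-form i_X Omega, and t(X, Y, Z) = i_Z i_Y i_X T = T(X, Y, Z).

    Clifford multiplication by a vector is exterior multiplication minus
    interior product, so the commutator of a vector with a 2-form b is -2 times
    i_X b. Commuting with Omega and commuting with a = i_X T are commuting
    operations when [a, Omega] = 0, and comparing their two compositions on a
    vector Y (commuting_contract) gives
      i_(w Y) i_X T = i_V Omega   with V dual to i_Y i_X T.
    Since i_Z i_V Omega = - i_V i_Z Omega = - i_V (w Z) = - i_(w Z) V, this
    reads t(X, w Y, Z) = - t(X, Y, w Z): the skew map w is an infinitesimal
    symmetry of each i_X T.

    Antisymmetry of T in its last two arguments turns this relation into the
    symmetry of A(X, Y, Z) = t(X, Y, w Z) in (Y, Z). As A is antisymmetric in
    (X, Y), the argument that gives uniqueness of the Levi-Civita connection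
    shows A = 0. Hence i_Z i_V Omega = 0 for all Z, so i_V Omega = 0 for every
    V dual to some i_Y i_X T.

    Finally Omega is nondegenerate: i_V is an antiderivation of the exterior
    product (contract_wedge), so i_V Omega = 0 implies i_V Omega^k = 0, and a
    nonzero form of top degree is killed by no nonzero vector. Therefore V = 0
    for all X and Y, that is i_Y i_X T = 0, and T = 0. *)

(** * Interior products in coordinates *)

Section Contraction.
Variables (R : comNzRingType) (n : nat).
Implicit Types (I J K : {set 'I_n}) (a b : forms R n) (X Y : 'rV[R]_n).

(** The exponent of the sign of moving e_i past the smaller factors of e_I. *)
Definition nbelow (i : 'I_n) I : nat := (\sum_(j in I) (j < i)%N)%N.
Definition nabove (i : 'I_n) I : nat := (\sum_(j in I) (i < j)%N)%N.

Lemma nbelowU1 i j K : j \notin K ->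
  nbelow i (j |: K) = ((j < i)%N + nbelow i K)%N.
Proof. by move=> jK; rewrite /nbelow big_setU1. Qed.

Lemma setD1_notin i I : i \notin I -> I :\ i = I.
Proof. by move=> iI; apply/setDidPl; rewrite disjoint_sym disjoints1. Qed.

Lemma disjointD1C i I J : [disjoint I :\ i & J] = [disjoint I & J :\ i].
Proof. by rewrite -!setI_eq0 setIDA setIDAC. Qed.

Lemma nbelowD1 i K : nbelow i (K :\ i) = nbelow i K.
Proof.
rewrite /nbelow; have [iK|iK] := boolP (i \in K).
  by rewrite [RHS](big_setD1 i) //= ltnn.
by rewrite setD1_notin.
Qed.

Lemma card_nbelow i I : #|I| = (nbelow i I + nabove i I + (i \in I))%N.
Proof.
rewrite /nbelow /nabove -big_split /= -sum1_card.
have -> : ((i \in I) : nat) = (\sum_(j in I) (j == i))%N.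
  have [iI|iI] := boolP (i \in I).
    by rewrite (big_setD1 i) //= eqxx big1 // => j /setD1P[/negPf->].
  by rewrite big1 // => j jI; case: eqP jI => // ->; rewrite (negPf iI).
rewrite -big_split; apply: eq_bigr => j _ /=.
by rewrite -(inj_eq val_inj) /=; case: ltngtP.
Qed.

Lemma coef_contract X a K :
  coef (contract X a) K =
  \sum_(i | i \notin K) X 0 i * ((-1) ^+ nbelow i K * coef a (i |: K)).
Proof.
rewrite coef_sum [RHS]big_mkcond; apply: eq_bigr => i _ /=.
rewrite coef_sum; case: ifP => iK; last first.
  rewrite big1 // => I iI; rewrite !coefZ coef_ebase.
  by case: eqP => [eK|]; [rewrite eK !inE eqxx in iK|rewrite !mulr0].
rewrite (bigD1 (i |: K)) ?setU11 //= [X in _ + X]big1 => [|I /andP[iI nI]].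
  rewrite !coefZ coef_ebase setU1K // eqxx mulr1 addr0.
  have -> : (\sum_(j in i |: K) (j < i)%N)%N = nbelow i K.
    by rewrite -/(nbelow i _) nbelowU1 // ltnn.
  by rewrite -mulrA [coef a _ * _]mulrC.
rewrite !coefZ coef_ebase; case: eqP => [eK|]; last by rewrite !mulr0.
by case/eqP: nI; rewrite eK setD1K.
Qed.

Lemma contractZ X c a : contract X (c *: a) = c *: contract X a.
Proof.
apply/formP=> K; rewrite coefZ !coef_contract mulr_sumr.
apply: eq_bigr => i _; rewrite coefZ !mulrA; congr (_ * _).
by rewrite mulrC mulrA.
Qed.

Lemma contractD X a b : contract X (a + b) = contract X a + contract X b.
Proof.
apply/formP=> K; rewrite coefD !coef_contract -big_split.
by apply: eq_bigr => i _; rewrite coefD !mulrDr.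
Qed.

Lemma contract0 X : contract X (0 : forms R n) = 0.
Proof. by have := contractZ X 0 0; rewrite !scale0r. Qed.

Lemma contractN X a : contract X (- a) = - contract X a.
Proof. by rewrite -!scaleN1r contractZ. Qed.

Lemma contract_sum X (I : Type) (r : seq I) (P : pred I) (F : I -> forms R n) :
  contract X (\sum_(t <- r | P t) F t) = \sum_(t <- r | P t) contract X (F t).
Proof. by elim/big_rec2: _ => [|t y z _ <-]; rewrite ?contract0 ?contractD. Qed.

(** The sign of extracting e_i and then e_j depends on the order only through
    the comparison of i and j, which flips when the two are exchanged. *)
Lemma contractC X Y a :
  contract X (contract Y a) = - contract Y (contract X a).
Proof.
have E U V K : coef (contract U (contract V a)) K =
    \sum_(i | i \notin K) \sum_(j | (j \notin K) && (j != i))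
      U 0 i * V 0 j * ((-1) ^+ (nbelow i K + nbelow j K + (i < j)%N) *
                       coef a (i |: (j |: K))).
  rewrite coef_contract; apply: eq_bigr => i iK.
  rewrite coef_contract !mulr_sumr; apply: eq_big => j.
    by rewrite !inE negb_or andbC.
  rewrite !inE negb_or => /andP[ji jK]; rewrite nbelowU1 //.
  rewrite -[RHS]mulrA; congr (_ * _); rewrite mulrCA; congr (_ * _).
  by rewrite mulrA -exprD setUCA addnCA addnC.
apply/formP=> K; rewrite coefN !E (exchange_big_dep (fun j => j \notin K)) /=.
  rewrite -sumrN; apply: eq_bigr => i iK; rewrite -sumrN; apply: eq_big => j.
    by rewrite iK eq_sym.
  move=> /and3P[_ _ ij]; rewrite [X 0 j * _]mulrC setUCA -mulrN -mulNr.
  congr (_ * (_ * _)); rewrite [(nbelow j K + _)%N]addnC !exprD -mulrN.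
  congr (_ * _); move: ij; rewrite neq_ltn.
  by case: ltngtP => // _ _; rewrite ?expr0 ?expr1 ?opprK.
by move=> i j _ /andP[].
Qed.

(** The coordinate of a on e_I is, up to sign, that of i_(e_i) a on e_(I - i),
    for any i in I: this needs I to be nonempty, hence the positive degree. *)
Lemma contract_eq0 p a :
  is_form p.+1 a -> (forall X, contract X a = 0) -> a = 0.
Proof.
move=> pa Xa; apply/formP=> I; rewrite coef0.
have [cI|/pa->//] := eqVneq #|I| p.+1.
have [i iI] : exists i, i \in I by apply/set0Pn; rewrite -card_gt0 cI.
have /(congr1 (fun b => coef b (I :\ i))) := Xa (delta_mx 0 i).
rewrite coef0 coef_contract (bigD1 i) ?setD11 //= big1 => [|j /andP[_ ji]].
  rewrite !mxE !eqxx mul1r addr0 setD1K //.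
  move/(congr1 ( *%R ((-1) ^+ nbelow i (I :\ i)))).
  by rewrite mulr0 signrMK.
by rewrite mxE (negPf ji) andbF mul0r.
Qed.

Lemma contract_ebase X I :
  contract X (ebase I) =
  \sum_(i in I) X 0 i *: ((-1) ^+ nbelow i I *: ebase (I :\ i)).
Proof.
rewrite /contract [RHS]big_mkcond; apply: eq_bigr => i _ /=.
have [iI|iI] := boolP (i \in I).
  rewrite (bigD1 I) //= [X in _ + X]big1 ?addr0 => [|J /andP[_ JI]].
    by rewrite coef_ebase eqxx mulr1.
  by rewrite coef_ebase (negPf JI) mulr0 scale0r.
rewrite big1 // => J iJ; rewrite coef_ebase; case: eqP => [eJ|].
  by rewrite -eJ iJ in iI.
by rewrite mulr0 scale0r.
Qed.

(** * The interior product is an antiderivation *)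

(** The exponent of the sign of e_I /\ e_J. *)
Definition inversions I J : nat := (\sum_(i in I) nbelow i J)%N.

Lemma wedge_ebaseE I J : [disjoint I & J] ->
  wedge (ebase I) (ebase J) = (-1) ^+ inversions I J *: ebase (I :|: J)
    :> forms R n.
Proof. by move=> dIJ; rewrite /wedge bilin_ebase /wedge_ebase dIJ. Qed.

Lemma wedge_ebase0 I J : ~~ [disjoint I & J] ->
  wedge (ebase I) (ebase J) = 0 :> forms R n.
Proof. by move=> /negPf dIJ; rewrite /wedge bilin_ebase /wedge_ebase dIJ. Qed.

Lemma inversionsD1l i I J : i \in I ->
  inversions I J = (nbelow i J + inversions (I :\ i) J)%N.
Proof. by move=> iI; rewrite /inversions (big_setD1 i). Qed.

Lemma inversionsD1r i I J : i \in J ->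
  inversions I J = (nabove i I + inversions I (J :\ i))%N.
Proof.
move=> iJ; rewrite /inversions /nabove -big_split; apply: eq_bigr => j _ /=.
by rewrite /nbelow (big_setD1 i).
Qed.

Lemma nbelowU i I J : [disjoint I & J] ->
  nbelow i (I :|: J) = (nbelow i I + nbelow i J)%N.
Proof.
move=> dIJ; rewrite /nbelow -bigU //; apply: eq_bigl => j.
by rewrite !inE.
Qed.

(** When I and J share only i, the product e_I /\ e_J vanishes, but each of the
    two terms of the Leibniz rule is a nonzero multiple of e_(I u J); these are
    the two signs, and they are opposite because removing e_i from e_I or from
    e_J amounts to moving it across the other factor. *)
Lemma sign_inversions_cancel i I J : i \in I -> i \in J ->
  (-1) ^+ nbelow i I * (-1) ^+ inversions (I :\ i) J +
  (-1) ^+ #|I| * ((-1) ^+ nbelow i J * (-1) ^+ inversions I (J :\ i)) = 0 :> R.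
Proof.
move=> iI iJ; rewrite (@inversionsD1l i I (J :\ i)) // nbelowD1.
rewrite (@inversionsD1r i (I :\ i) J) // (card_nbelow i) iI.
rewrite /nabove (big_setD1 i iI) /= ltnn add0n -/(nabove _ _) !exprD expr1.
by rewrite signrMK mulrN1 mulNr -mulrA addrN.
Qed.

(** Compared component by component along X: if I and J are disjoint, i belongs
    to at most one of them, and a single term of the right-hand side matches the
    left-hand side; otherwise the left-hand side is 0, and the right-hand side
    can be nonzero only if i is the sole common element, where it cancels. *)
Lemma contract_wedge_ebase X I J :
  contract X (wedge (ebase I) (ebase J)) =
  wedge (contract X (ebase I)) (ebase J) +
  (-1) ^+ #|I| *: wedge (ebase I) (contract X (ebase J)).
Proof.
pose D i K : forms R n :=
  if i \in K then (-1) ^+ nbelow i K *: ebase (K :\ i) else 0.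
have cE K : contract X (ebase K) = \sum_i X 0 i *: D i K.
  rewrite contract_ebase big_mkcond; apply: eq_bigr => i _.
  by rewrite /D; case: ifP; rewrite ?scaler0.
rewrite !cE /wedge bilin_suml bilin_sumr scaler_sumr -big_split /=.
rewrite -!/(wedge _ _).
have [dIJ|dIJ] := boolP [disjoint I & J].
  rewrite wedge_ebaseE // contractZ cE scaler_sumr; apply: eq_bigr => i _.
  rewrite bilinZl bilinZr !scalerA -![_ * X 0 i]mulrC -!scalerA -scalerDr.
  congr (_ *: _); rewrite /D in_setU nbelowU //.
  have [iI|iI] := boolP (i \in I).
    have iJ : i \notin J by rewrite (disjointFr dIJ).
    rewrite (negPf iJ) bilin0r scaler0 addr0 bilinZl -/(wedge _ _).
    rewrite wedge_ebaseE; last first.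
      exact: disjointWl (subD1set I i) dIJ.
    rewrite !scalerA (@inversionsD1l i) // !exprD mulrC -mulrA signrMK.
    congr (_ *: ebase _); by rewrite setDUl (setD1_notin (I := J)).
  have [iJ|iJ] := boolP (i \in J); last first.
    by rewrite bilin0l bilin0r !scaler0 addr0.
  rewrite bilin0l add0r bilinZr -/(wedge _ _) wedge_ebaseE; last first.
    exact: disjointWr (subD1set J i) dIJ.
  rewrite !scalerA (@inversionsD1r i) // (card_nbelow i) (negPf iI) addn0.
  rewrite !exprD.
  congr (_ *: ebase _); last first.
    by rewrite setDUl (setD1_notin (I := I)).
  by rewrite mulrC -!mulrA; congr (_ * _); rewrite mulrCA.
rewrite wedge_ebase0 // contract0 big1 // => i _.
rewrite bilinZl bilinZr !scalerA -![_ * X 0 i]mulrC -!scalerA -scalerDr.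
suff -> : wedge (D i I) (ebase J) + (-1) ^+ #|I| *: wedge (ebase I) (D i J) = 0.
  exact: scaler0.
have [/andP[iI iJ]|nIJ] := boolP ((i \in I) && (i \in J)).
  rewrite /D iI iJ /wedge bilinZl bilinZr -!/(wedge _ _).
  have [d|d] := boolP [disjoint I :\ i & J]; last first.
    by rewrite !wedge_ebase0 -?disjointD1C // !scaler0 addr0.
  rewrite !wedge_ebaseE -?disjointD1C // !scalerA.
  have -> : I :\ i :|: J = I :|: J :\ i.
    by apply/setP=> j; rewrite !inE; case: eqP => // ->; rewrite iI iJ.
  by rewrite -scalerDl -mulrA sign_inversions_cancel ?scale0r.
rewrite /D; have [iI|iI] := boolP (i \in I).
  rewrite iI /= in nIJ; rewrite (negPf nIJ) /wedge bilinZl -/(wedge _ _).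
  by rewrite wedge_ebase0 ?disjointD1C ?setD1_notin // bilin0r !scaler0 addr0.
rewrite /wedge bilin0l add0r; have [iJ|iJ] := boolP (i \in J).
  rewrite bilinZr -/(wedge _ _) wedge_ebase0 ?scaler0 //.
  by rewrite -disjointD1C setD1_notin.
by rewrite bilin0r scaler0.
Qed.

Lemma contract_wedge_ebasel X I b :
  contract X (wedge (ebase I) b) =
  wedge (contract X (ebase I)) b +
  (-1) ^+ #|I| *: wedge (ebase I) (contract X b).
Proof.
move: b; apply: form_ext => [||J]; last exact: contract_wedge_ebase.
  by split=> [x y|c x]; rewrite /wedge ?bilinDr ?bilinZr ?contractD ?contractZ.
split=> [x y|c x]; rewrite /wedge.
  by rewrite contractD !bilinDr scalerDr addrACA.
by rewrite contractZ !bilinZr scalerDr !scalerA [c * _]mulrC.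
Qed.

Lemma contract_wedge p X a b : is_form p a ->
  contract X (wedge a b) =
  wedge (contract X a) b + (-1) ^+ p *: wedge a (contract X b).
Proof.
move=> pa; rewrite [a in LHS]form_ebase [a in X in X + _]form_ebase.
rewrite [a in X in _ + X]form_ebase /wedge bilin_suml !contract_sum !bilin_suml.
rewrite scaler_sumr -big_split; apply: eq_bigr => I _ /=.
have [cI|nI] := eqVneq #|I| p; last first.
  by rewrite pa // !scale0r !(contract0, bilin0l) scaler0 addr0.
rewrite !(bilinZl, contractZ) -!/(wedge _ _) contract_wedge_ebasel cI.
by rewrite scalerDr !scalerA [_ * coef _ _]mulrC.
Qed.

(** * Exterior powers *)

Lemma is_form_wedge p q a b :
  is_form p a -> is_form q b -> is_form (p + q) (wedge a b).
Proof.
move=> pa qb K nK; rewrite /wedge /bilin coef_sum big1 // => I _.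
rewrite coef_sum big1 // => J _; rewrite coefZ.
have [cI|/pa->] := eqVneq #|I| p; last by rewrite !mul0r.
have [cJ|/qb->] := eqVneq #|J| q; last by rewrite mulr0 mul0r.
rewrite /wedge_ebase; case: ifP => [|_]; last by rewrite coef0 mulr0.
rewrite -setI_eq0 => /eqP dIJ; rewrite coefZ coef_ebase; case: eqP => [eK|].
  by rewrite eK cardsU dIJ cards0 subn0 cI cJ eqxx in nK.
by rewrite !mulr0.
Qed.

Lemma wedge_powS a k : wedge_pow a k.+1 = wedge a (wedge_pow a k).
Proof. by case: k => //; rewrite /wedge_pow /= wedgef1. Qed.

Lemma is_form_wedge_pow p a k :
  is_form p a -> is_form (k * p) (wedge_pow a k).
Proof.
move=> pa; elim: k => [I|k IHk]; last first.
  by rewrite wedge_powS mulSn; apply: is_form_wedge.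
by rewrite coef_ebase -cards_eq0 => /negPf->.
Qed.

Lemma contract_wedge_pow X a k :
  is_form 2 a -> contract X a = 0 -> contract X (wedge_pow a k) = 0.
Proof.
move=> a2 Xa; elim: k => [|k IHk].
  by rewrite contract_ebase big_set0.
rewrite wedge_powS (contract_wedge _ _ a2) Xa IHk.
by rewrite /wedge bilin0l bilin0r scaler0 addr0.
Qed.

(** * Vectors and 2-forms in the Clifford algebra *)

(** The vector dual to a 1-form, inverse to [vec] on 1-forms. *)
Definition unvec a : 'rV[R]_n := \row_i coef a [set i].

Lemma coef_vec X I : coef (vec X) I = \sum_(i | I == [set i]) X 0 i.
Proof.
rewrite coef_sum [RHS]big_mkcond; apply: eq_bigr => i _.
by rewrite coefZ coef_ebase; case: eqP; rewrite ?mulr1 ?mulr0.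
Qed.

Lemma coef_vec1 X i : coef (vec X) [set i] = X 0 i.
Proof.
by rewrite coef_vec (big_pred1 i) // => j; rewrite (inj_eq set1_inj) eq_sym.
Qed.

Lemma unvecK a : is_form 1 a -> vec (unvec a) = a.
Proof.
move=> a1; apply/formP=> I; have [/eqP/cards1P[i ->]|cI] := eqVneq #|I| 1%N.
  by rewrite coef_vec1 mxE.
rewrite a1 // coef_vec big1 // => i /eqP eI.
by rewrite eI cards1 in cI.
Qed.

Lemma contract_vec X Y :
  contract X (vec Y) = (\sum_i X 0 i * Y 0 i) *: one_form.
Proof.
rewrite contract_sum scaler_suml; apply: eq_bigr => i _.
rewrite contractZ contract_ebase big_set1 scalerA mulrC.
by rewrite /nbelow big_set1 ltnn scale1r setDv.
Qed.

Lemma contract_vecC X Y : contract X (vec Y) = contract Y (vec X).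
Proof.
by rewrite !contract_vec; congr (_ *: _); apply: eq_bigr => i _; rewrite mulrC.
Qed.

Lemma vec_delta i : vec (delta_mx 0 i) = ebase [set i] :> forms R n.
Proof.
rewrite /vec (bigD1 i) //= big1 => [|j ji].
  by rewrite !mxE !eqxx scale1r addr0.
by rewrite mxE (negPf ji) andbF scale0r.
Qed.

Lemma contract_delta i I :
  contract (delta_mx 0 i) (ebase I) =
  if i \in I then (-1) ^+ nbelow i I *: ebase (I :\ i) else 0 :> forms R n.
Proof.
have d j : j != i -> (delta_mx 0 i : 'rV[R]_n) 0 j = 0.
  by rewrite mxE => /negPf->; rewrite andbF.
rewrite contract_ebase; case: ifP => iI; last first.
  rewrite big1 // => j jI; rewrite d ?scale0r //.
  by apply: contraTneq jI => ->; rewrite iI.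
rewrite (bigD1 i) //= big1 => [|j /andP[_ /d->]]; last by rewrite scale0r.
by rewrite !mxE !eqxx scale1r addr0.
Qed.

(** The companion of [clif_vecl] for right multiplication. Moving e_i across e_I
    with #|I| = 2 gives no sign if i is not in I and a minus sign if i is in I:
    this keeps the exterior part and changes the sign of the interior one. *)
Lemma clif_vecr X a :
  is_form 2 a -> clif a (vec X) = wedge (vec X) a + contract X a.
Proof.
move=> a2; rewrite [a in LHS]form_ebase [a in X in X + _]form_ebase.
rewrite [a in X in _ + X]form_ebase /clif /wedge contract_sum bilin_suml.
rewrite (bilin_sumr (@wedge_ebase R n)) -big_split; apply: eq_bigr => I _ /=.
rewrite contractZ bilinZl bilinZr -scalerDr.
have [cI|/a2->] := eqVneq #|I| 2; last by rewrite !scale0r.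
congr (_ *: _); rewrite contract_ebase /vec bilin_suml bilin_sumr.
rewrite [X in _ + X]big_mkcond -big_split; apply: eq_bigr => i _ /=.
rewrite bilinZl bilinZr.
have -> : (if i \in I
           then X 0 i *: ((-1) ^+ nbelow i I *: ebase (I :\ i)) else 0) =
          X 0 i *: contract (delta_mx 0 i) (ebase I) :> forms R n.
  by rewrite contract_delta; case: ifP; rewrite ?scaler0.
rewrite -scalerDr -/(clif _ _) -/(wedge _ _); congr (_ *: _).
rewrite clif_ebaseX cI cards1 muln1 exprD sqrrN expr1n mul1r.
rewrite -vec_delta clif_vecl vec_delta.
rewrite contract_delta; case: ifP => iI.
  rewrite (setIidPr _) ?sub1set // cards1 expr1 wedge_ebase0; last first.
    by rewrite disjoints1 iI.
  by rewrite sub0r scaleN1r opprK add0r.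
have /eqP-> : I :&: [set i] == set0.
  by rewrite setI_eq0 disjoint_sym disjoints1 iI.
by rewrite cards0 expr0 scale1r subr0 addr0.
Qed.

Lemma bracket_vec X a :
  is_form 2 a -> bracket (vec X) a = (- 2%:R) *: contract X a.
Proof.
move=> a2; rewrite /bracket clif_vecl clif_vecr // scaleNr scaler_nat mulr2n.
by rewrite !opprD addrACA subrr add0r.
Qed.

Lemma bracketZl c a b : bracket (c *: a) b = c *: bracket a b.
Proof. by rewrite /bracket /clif bilinZl bilinZr scalerBr. Qed.

(** The Jacobi identity in the case where b and c commute. *)
Lemma bracketC_nested a b c :
  clif b c = clif c b -> bracket (bracket a b) c = bracket (bracket a c) b.
Proof.
have BN (u v w : forms R n) : clif (u - v) w = clif u w - clif v w.
  by rewrite -scaleN1r /clif bilinDl bilinZl scaleN1r.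
have NB (u v w : forms R n) : clif w (u - v) = clif w u - clif w v.
  by rewrite -scaleN1r /clif bilinDr bilinZr scaleN1r.
move=> bc; rewrite /bracket !BN !NB -!clifA bc !clifA bc.
by rewrite !opprB !addrA [LHS]addrAC [X in X + _]addrAC [LHS]addrAC.
Qed.

Lemma bracket_bracket_vec Y a b :
  is_form 2 a -> is_form 2 b ->
  bracket (bracket (vec Y) b) a = 4%:R *: contract (unvec (contract Y b)) a.
Proof.
move=> a2 b2; rewrite (bracket_vec Y b2) bracketZl.
have {1}<- : vec (unvec (contract Y b)) = contract Y b.
  by apply/unvecK/is_form_contract.
by rewrite (bracket_vec _ a2) scalerA mulrNN -natrM.
Qed.

End Contraction.

(** * Nondegenerate 2-forms and the vanishing of T *)

Section Main.
Variables (F : fieldType) (n : nat).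
Implicit Types (a b T Omega : forms F n) (X Y Z V : 'rV[F]_n).

(** A form of top degree is c e_1 /\ ... /\ e_n; the coordinate of its interior
    product by V on the set of all indices but i is c V_i up to sign. *)
Lemma contract_top_eq0 a V :
  is_form n a -> a <> 0 -> contract V a = 0 -> V = 0.
Proof.
move=> an a0 Va; apply/rowP=> i; rewrite mxE.
have cT : coef a setT != 0.
  apply: contra_notN a0 => /eqP aT; apply/formP=> I; rewrite coef0.
  have [cI|/an//] := eqVneq #|I| n.
  have /eqP-> : I == setT by rewrite eqEcard subsetT cardsT card_ord cI leqnn.
  exact: aT.
have /(congr1 (fun b => coef b (setT :\ i))) := Va.
rewrite coef0 coef_contract (big_pred1 i) => [|j]; last first.
  by rewrite !inE andbT negbK.
rewrite setD1K ?inE // => /eqP; rewrite !mulf_eq0 signr_eq0 (negPf cT) !orbF.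
by move/eqP.
Qed.

(** If the top exterior power of Omega is nonzero, then Omega is nondegenerate,
    because a vector that kills Omega also kills this power. *)
Lemma contract_symplectic_eq0 k Omega V :
  n = (2 * k)%N -> is_form 2 Omega -> wedge_pow Omega k <> 0 ->
  contract V Omega = 0 -> V = 0.
Proof.
move=> en O2 Ok VO; apply: (contract_top_eq0 (a := wedge_pow Omega k)) => //.
  by have := is_form_wedge_pow (k := k) O2; rewrite mulnC -en.
exact: contract_wedge_pow.
Qed.

(** As b varies, Y |-> unvec (contract Y b) is the vector representation of
    2-forms, and both sides are, up to duality, the two orders of composition of
    the endomorphisms of a and Omega. The factor 4 cancelled here comes from the
    -2 of each commutator. *)
Lemma commuting_contract a Omega Y : 2%:R != 0 :> F ->
  is_form 2 a -> is_form 2 Omega -> bracket a Omega = 0 ->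
  contract (unvec (contract Y Omega)) a =
  contract (unvec (contract Y a)) Omega.
Proof.
move=> F2 a2 O2 /eqP; rewrite subr_eq0 => /eqP aO.
have /(@scalerI _ _ _ _) : 4%:R *: contract (unvec (contract Y Omega)) a =
    4%:R *: contract (unvec (contract Y a)) Omega.
  rewrite -(bracket_bracket_vec Y a2 O2) -(bracket_bracket_vec Y O2 a2).
  exact: bracketC_nested.
by apply; rewrite (natrM _ 2 2) mulf_neq0.
Qed.

Lemma contract_commuting_eq0 k T Omega :
  2%:R != 0 :> F -> n = (2 * k)%N -> is_form 3 T -> is_form 2 Omega ->
  wedge_pow Omega k <> 0 ->
  (forall X, bracket (contract X T) Omega = 0) -> T = 0.
Proof.
move=> F2 en T3 O2 Ok TO.
pose w X := unvec (contract X Omega).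
pose t X Y Z := contract Z (contract Y (contract X T)).
have T2 X : is_form 2 (contract X T) by apply: is_form_contract.
have T1 X Y : is_form 1 (contract Y (contract X T)) by apply: is_form_contract.
have vw X : vec (w X) = contract X Omega by apply/unvecK/is_form_contract.
have t12 X Y Z : t X Y Z = - t Y X Z by rewrite /t (contractC Y X) contractN.
have t23 X Y Z : t X Y Z = - t X Z Y by rewrite /t contractC.
pose u X Y := unvec (contract Y (contract X T)).
have vu X Y : vec (u X Y) = contract Y (contract X T) by apply: unvecK.
have uO X Y : contract (u X Y) Omega = contract (w Y) (contract X T).
  by rewrite /u /w -commuting_contract.
have tw X Y Z : t X (w Y) Z = - t X Y (w Z).
  by rewrite /t -uO contractC -vw contract_vecC vu.
have tS X Y Z : t X Y (w Z) = t X Z (w Y).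
  by apply: oppr_inj; rewrite -tw t23.
have t0 X Y Z : t X Y (w Z) = 0.
  have : t X Y (w Z) = - t X Y (w Z).
    (* t(X, Y, w Z) is symmetric in (Y, Z) and antisymmetric in (X, Y). *)
    by rewrite {1}tS (t12 X) tS (t12 Z) tS opprK (t12 Y).
  move/eqP; rewrite -addr_eq0 -mulr2n -scaler_nat scaler_eq0 (negPf F2).
  by move/eqP.
apply: (contract_eq0 T3) => X; apply: (contract_eq0 (T2 X)) => Y.
rewrite -vu (_ : u X Y = 0); last first.
  apply: (contract_symplectic_eq0 en O2 Ok).
  apply: (@contract_eq0 _ _ 0) => [|Z]; first exact: is_form_contract.
  by rewrite uO -/(t _ _ _) tw t0 oppr0.
by rewrite /vec big1 // => i _; rewrite mxE scale0r.
Qed.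

End Main.

Theorem proposition4p3 (R : realType) (k : nat) (T : forms R (2 * k)%N)
  (hT : is_form 3 T)
  (hOmega : exists Omega : forms R (2 * k)%N,
     [/\ is_form 2 Omega,
         wedge_pow Omega k <> 0
       & forall a : forms R (2 * k)%N, gT T a -> bracket a Omega = 0]) :
  T = 0.
Proof.
case: hOmega => Omega [O2 Ok TO].
apply: (@contract_commuting_eq0 _ _ k T Omega) => // [|X].
  by rewrite Num.Theory.pnatr_eq0.
by apply: TO => S _; apply; exists X.
Qed.
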